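(* Let $A$ be a finite dimensional weak $C^*$-Hopf algebra with dual $\hat A$ and let $M$ be a unital $*$-algebra. There is a one-to-one correspondence between left $A$-module algebra actions $\triangleright:A\otimes M\to M$ and right $\hat A$-comodule algebra coactions $\hat\rho:M\to M\otimes\hat A$, given by $$a\triangleright m=(\mathrm{id}_M\otimes a)(\hat\rho(m)),\qquad a\in A,\ m\in M.$$
   Context: A finite dimensional weak $C^*$-Hopf algebra is a finite dimensional $C^*$-algebra $A$ (unit $1$) with linear maps $\Delta:A\to A\otimes A$, $\varepsilon:A\to\mathbb C$, $S:A\to A$ such that, for all $x,y,z\in A$ in Sweedler notation: $\Delta(xy)=\Delta(x)\Delta(y)$; $\Delta(x^* )=\Delta(x)^*$; $(\Delta\otimes\mathrm{id})\Delta=(\mathrm{id}\otimes\Delta)\Delta$; $(\Delta(1)\otimes1)(1\otimes\Delta(1))=1_{(1)}\otimes1_{(2)}\otimes1_{(3)}$; $(\varepsilon\otimes\mathrm{id})\Delta=\mathrm{id}=(\mathrm{id}\otimes\varepsilon)\Delta$; $\varepsilon(xyz)=\varepsilon(xy_{(1)})\varepsilon(y_{(2)}z)$; $S(x_{(1)})x_{(2)}=1_{(1)}\varepsilon(x1_{(2)})$; $x_{(1)}S(x_{(2)})=\varepsilon(1_{(1)}x)1_{(2)}$; $S(x_{(1)})x_{(2)}S(x_{(3)})=S(x)$. ($\Delta(1)\neq 1\otimes 1$ in general; $S$ is automatically invertible.) Put $x_*:=S(x)^*$. The dual $\hat A$ is the dual vector space with $\langle\psi\varphi|x\rangle=\langle\psi\otimes\varphi|\Delta(x)\rangle$,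 $\langle\hat\Delta(\psi)|x\otimes y\rangle=\langle\psi|xy\rangle$, $\hat1=\varepsilon$, $\hat\varepsilon(\psi)=\langle\psi|1\rangle$, $\langle\hat S(\psi)|x\rangle=\langle\psi|S(x)\rangle$, $\langle\psi^*|x\rangle=\overline{\langle\psi|x_*\rangle}$; it is again a finite dimensional weak $C^*$-Hopf algebra, with dual $A$ (elements $a\in A$ act as functionals on $\hat A$). A left $A$-module algebra action on $M$ is a linear map $\triangleright:A\otimes M\to M$ with $(ab)\triangleright m=a\triangleright(b\triangleright m)$, $1\triangleright m=m$, $a\triangleright(mn)=(a_{(1)}\triangleright m)(a_{(2)}\triangleright n)$, $(a\triangleright m)^*=a_*\triangleright m^*$, $a\triangleright1_M=(a_{(1)}S(a_{(2)}))\triangleright1_M$ for all $a,b\in A$, $m,n\in M$. A right $\hat A$-comodule algebra coaction on $M$ is a (in general non-unital) $*$-algebra homomorphism $\hat\rho:M\to M\otimes\hat A$ such that $(\hat\rho\otimes\mathrm{id})\circ\hat\rho=(\mathrm{id}\otimes\hat\Delta)\circ\hat\rho$, $(\mathrm{id}\otimes\hat\varepsilon)\circ\hat\rho=\mathrm{id}_M$ and $(1_M\otimes\hat\Delta(\hat1))(\hat\rho(1_M)\otimes\hat1)=((\mathrm{id}\otimes\hat\Delta)\circ\hat\rho)(1_M)$. If $M$ is a von Neumann algebra, both the maps $a\triangleright$ and $\hat\rho$ are required to be weakly continuous. *)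

(* Defs.v *)
From HB Require Import structures.
From mathcomp Require Import all_boot all_order all_algebra sesquilinear falgebra.
From mathcomp Require Import complex.
From mathcomp Require Import all_classical all_reals.
From mathcomp Require Import topology normedtype.

Set Implicit Arguments.
Unset Strict Implicit.
Unset Printing Implicit Defensive.

Import Order.TTheory GRing.Theory Num.Theory.
Import numFieldNormedType.Exports.

Local Open Scope classical_set_scope.
Local Open Scope ring_scope.

(* The tensor product V (x) W with W finite dimensional, in the coordinates
   given by the basis [tbase W] of W: t stands for the sum over i of
   t i (x) tbase W i. See [tlift_pure], [tlift_linear], [tlift_unique] for the
   universal property. *)
Section Tensor.
Variable K : fieldType.
Implicit Types V W U : lmodType K.

Definition tbase (W : vectType K) (i : 'I_(\dim {:W})) : W :=
  (vbasis {:W})`_i.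
Definition tcoord (W : vectType K) (i : 'I_(\dim {:W})) (w : W) : K :=
  coord (vbasis {:W}) i w.

Definition tens (V : lmodType K) (W : vectType K) : Type :=
  {ffun 'I_(\dim {:W}) -> V}.

HB.instance Definition _ V (W : vectType K) := GRing.Lmodule.on (tens V W).
HB.instance Definition _ (V W : vectType K) := Vector.on (tens V W).

Definition pure V (W : vectType K) (v : V) (w : W) : tens V W :=
  [ffun i => tcoord i w *: v].

Local Notation "v ⊗ w" := (pure v w) (at level 40, left associativity).

(* For bilinear f, [tlift f] is the induced linear map on V (x) W; in Sweedler
   notation, [tlift (fun v w => f v w) t] is f(t_(1), t_(2)). *)
Definition tlift V (W : vectType K) (U : nmodType) (f : V -> W -> U)
    (t : tens V W) : U :=
  \sum_i f (t i) (tbase i).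

(* f (x) g, for f and g both linear or both conjugate-linear. *)
Definition tmap V (W : vectType K) V' (W' : vectType K)
    (f : V -> V') (g : W -> W') : tens V W -> tens V' W' :=
  tlift (fun v w => pure (f v) (g w)).

Definition tassoc V (W U : vectType K) :
    tens V (tens W U) -> tens (tens V W) U :=
  tlift (fun v => tlift (fun w u => pure (pure v w) u)).

Definition bilin V W (U : lmodType K) (f : V -> W -> U) : Prop :=
  (forall w, linear (f^~ w)) /\ (forall v, linear (f v)).

Lemma tbase_sum (W : vectType K) (w : W) : w = \sum_i tcoord i w *: tbase i.
Proof. by rewrite {1}(coord_vbasis (memvf w)). Qed.

Lemma tcoord_tbase (W : vectType K) (i j : 'I_(\dim {:W})) :
  tcoord j (tbase i) = (i == j)%:R.
Proof. by rewrite /tcoord coord_free // (basis_free (vbasisP _)). Qed.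

Lemma pure_bilin V (W : vectType K) : bilin (@pure V W).
Proof.
split=> [w k v v'|v k w w']; apply/ffunP=> i; rewrite !ffunE.
  by rewrite scalerDr !scalerA mulrC.
by rewrite /tcoord linearP scalerDl scalerA.
Qed.

Lemma tens_sum V (W : vectType K) (t : tens V W) :
  t = \sum_i pure (t i) (tbase i).
Proof.
apply/ffunP=> j; rewrite sum_ffunE (bigD1 j) //= ffunE tcoord_tbase eqxx scale1r.
rewrite big1 ?addr0 // => i ij.
by rewrite ffunE tcoord_tbase (negPf ij) scale0r.
Qed.

Lemma tlift_linear V (W : vectType K) (U : lmodType K) (f : V -> W -> U) :
  bilin f -> linear (tlift f).
Proof.
move=> [fl _] k s t; rewrite /tlift scaler_sumr -big_split /=.
by apply: eq_bigr => i _; rewrite !ffunE fl.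
Qed.

Lemma tlift_pure V (W : vectType K) (U : lmodType K) (f : V -> W -> U) v w :
  bilin f -> tlift f (pure v w) = f v w.
Proof.
move=> [fl fr]; rewrite /tlift.
have lin0 (X : lmodType K) (g : X -> U) :
    linear g -> (forall k x, g (k *: x) = k *: g x) /\ {morph g : x y / x + y}.
  move=> gl; split=> [k x|x y]; last by have := gl 1 x y; rewrite !scale1r.
  have g0 : g 0 = 0.
    by have /esym/(canRL (addrK _)) := gl 1 0 0; rewrite !scale1r addr0 subrr.
  by have := gl k x 0; rewrite g0 !addr0.
rewrite [in RHS](tbase_sum w).
have [frZ frD] := lin0 _ _ (fr v).
rewrite (big_morph (f v) frD (_ : _ = 0)); last first.
  by have := frZ 0 0; rewrite !scale0r.
apply: eq_bigr => i _; rewrite ffunE frZ.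
by have [flZ _] := lin0 _ _ (fl (tbase i)); rewrite flZ.
Qed.

Lemma tlift_unique V (W : vectType K) (U : lmodType K)
    (g : {linear tens V W -> U}) (t : tens V W) :
  g t = tlift (fun v w => g (pure v w)) t.
Proof. by rewrite {1}[t]tens_sum linear_sum. Qed.

Lemma lin_tlift V (W : vectType K) (X Y : lmodType K) (L : X -> Y)
    (f : V -> W -> X) (t : tens V W) :
  linear L -> L (tlift f t) = tlift (fun v w => L (f v w)) t.
Proof.
move=> Ll; pose F : {linear X -> Y} := HB.pack L (GRing.isLinear.Build K X Y _ L Ll).
by rewrite -[L]/(F : X -> Y) [LHS]linear_sum.
Qed.

Lemma tlift_tmap V (W : vectType K) V' (W' : vectType K) (U : lmodType K)
    (f : V' -> W' -> U) (g : V -> V') (h : W -> W') (t : tens V W) :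
  bilin f -> tlift f (tmap g h t) = tlift (fun v w => f (g v) (h w)) t.
Proof.
move=> fb; rewrite /tmap (lin_tlift _ _ (tlift_linear fb)).
by apply: eq_bigr => i _; rewrite tlift_pure.
Qed.

Lemma tlift_tassoc V (W X : vectType K) (U : lmodType K)
    (f : tens V W -> X -> U) (t : tens V (tens W X)) :
  bilin f ->
  tlift f (tassoc t) = tlift (fun v => tlift (fun w x => f (v ⊗ w) x)) t.
Proof.
move=> fb; rewrite /tassoc (lin_tlift _ _ (tlift_linear fb)).
apply: eq_bigr => i _; rewrite (lin_tlift _ _ (tlift_linear fb)).
by apply: eq_bigr => j _; rewrite tlift_pure.
Qed.

End Tensor.


Notation "v ⊗ w" := (pure v w) (at level 40, left associativity) : ring_scope.

(* The algebra V (x) W, with (v (x) w)(v' (x) w') = vv' (x) ww'. *)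
Section TensorAlgebra.
Variables (K : fieldType) (V : algType K) (W : falgType K).

Definition tens_mul (s t : tens V W) : tens V W :=
  tlift (fun v w => tlift (fun v' w' => (v * v') ⊗ (w * w')) t) s.

Definition tens_one : tens V W := 1 ⊗ 1.

Let bilinD (X Y Z : lmodType K) (f : X -> Y -> Z) : bilin f ->
  (forall x x' y, f (x + x') y = f x y + f x' y) *
  (forall x y y', f x (y + y') = f x y + f x y').
Proof.
move=> [fl fr]; split=> [x x' y|x y y'].
  by have := fl y 1 x x'; rewrite !scale1r.
by have := fr x 1 y y'; rewrite !scale1r.
Qed.

Let mulb (v : V) (w : W) : bilin (fun v' w' => (v * v') ⊗ (w * w')).
Proof.
have [pl pr] := pure_bilin V W; split=> [w' k a b|v' k a b].
  by rewrite mulrDr -scalerAr pl.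
by rewrite mulrDr -scalerAr pr.
Qed.

Let mulb2 (t : tens V W) :
  bilin (fun v w => tlift (fun v' w' => (v * v') ⊗ (w * w')) t).
Proof.
have [pl pr] := pure_bilin V W; split=> [w k a b|v k a b];
  rewrite /tlift scaler_sumr -big_split /=; apply: eq_bigr => i _.
  by rewrite mulrDl -scalerAl pl.
by rewrite mulrDl -scalerAl pr.
Qed.

Lemma tens_mul_pure v w v' w' :
  tens_mul (v ⊗ w) (v' ⊗ w') = (v * v') ⊗ (w * w').
Proof. by rewrite /tens_mul tlift_pure // tlift_pure. Qed.

Lemma tens_mul_bilin : bilin tens_mul.
Proof.
split=> [t|s k t t']; first exact: tlift_linear.
rewrite /tens_mul [X in _ = k *: X + _]/tlift [X in _ = _ + X]/tlift.
rewrite scaler_sumr -big_split /=; apply: eq_bigr => i _.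
exact: (tlift_linear (mulb _ _)).
Qed.

Fact tens_mulDl : left_distributive tens_mul +%R.
Proof. by move=> x y z; rewrite (bilinD tens_mul_bilin).1. Qed.

Fact tens_mulDr : right_distributive tens_mul +%R.
Proof. by move=> x y z; rewrite (bilinD tens_mul_bilin).2. Qed.

Let mul0t t : tens_mul 0 t = 0.
Proof. by apply: (addIr (tens_mul 0 t)); rewrite -tens_mulDl !add0r. Qed.

Let mult0 t : tens_mul t 0 = 0.
Proof. by apply: (addIr (tens_mul t 0)); rewrite -tens_mulDr !add0r. Qed.

Let suml (I : finType) (F : I -> tens V W) t :
  tens_mul (\sum_i F i) t = \sum_i tens_mul (F i) t.
Proof. exact: (big_morph (tens_mul^~ t) (fun x y => tens_mulDl x y t)). Qed.

Let sumr (I : finType) (F : I -> tens V W) t :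
  tens_mul t (\sum_i F i) = \sum_i tens_mul t (F i).
Proof. exact: (big_morph (tens_mul t) (tens_mulDr t)). Qed.

Fact tens_mulA : associative tens_mul.
Proof.
move=> x y z; rewrite [x]tens_sum !suml; apply: eq_bigr => i _.
rewrite [y]tens_sum suml !sumr suml; apply: eq_bigr => j _.
rewrite [z]tens_sum !sumr; apply: eq_bigr => k _.
by rewrite !tens_mul_pure !mulrA.
Qed.

Fact tens_mul1 : left_id tens_one tens_mul.
Proof.
move=> x; rewrite {1}[x]tens_sum sumr [RHS]tens_sum; apply: eq_bigr => i _.
by rewrite tens_mul_pure !mul1r.
Qed.

Fact tens_1mul : right_id tens_one tens_mul.
Proof.
move=> x; rewrite {1}[x]tens_sum suml [RHS]tens_sum; apply: eq_bigr => i _.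
by rewrite tens_mul_pure !mulr1.
Qed.

Fact tens_one_neq0 : tens_one != 0.
Proof.
apply/eqP => /ffunP t0.
have /eqP[] := oner_neq0 W; rewrite [LHS]tbase_sum big1 // => i _.
apply/eqP; have /eqP := t0 i; rewrite !ffunE !scaler_eq0.
by rewrite oner_eq0 orbF => ->.
Qed.

HB.instance Definition _ := GRing.Zmodule_isNzRing.Build (tens V W)
  tens_mulA tens_mul1 tens_1mul tens_mulDl tens_mulDr tens_one_neq0.

Fact tens_scaleAl (k : K) (x y : tens V W) : k *: (x * y) = (k *: x) * y.
Proof. by have := tens_mul_bilin.1 y k x 0; rewrite mul0t !addr0. Qed.

Fact tens_scaleAr (k : K) (x y : tens V W) : k *: (x * y) = x * (k *: y).
Proof. by have := tens_mul_bilin.2 x k y 0; rewrite mult0 !addr0. Qed.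

HB.instance Definition _ :=
  GRing.Lmodule_isLalgebra.Build K (tens V W) tens_scaleAl.
HB.instance Definition _ :=
  GRing.Lalgebra_isAlgebra.Build K (tens V W) tens_scaleAr.

End TensorAlgebra.

HB.mixin Record isStarAlgebra (C : numClosedFieldType) M of GRing.Algebra C M := {
  star : M -> M;
  starD : forall x y, star (x + y) = star x + star y;
  starZ : forall (k : C) x, star (k *: x) = k^* *: star x;
  starM : forall x y, star (x * y) = star y * star x;
  starK : involutive star
}.
#[short(type="starAlgType")]
HB.structure Definition StarAlgebra (C : numClosedFieldType) :=
  {M of GRing.Algebra C M & isStarAlgebra C M}.

HB.mixin Record isCStar (C : numClosedFieldType) A of StarAlgebra C A := {
  cnorm : A -> C;
  cnorm_ge0 : forall x, 0 <= cnorm x;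
  cnorm_eq0 : forall x, cnorm x = 0 -> x = 0;
  cnormZ : forall (k : C) x, cnorm (k *: x) = `|k| * cnorm x;
  cnormD : forall x y, cnorm (x + y) <= cnorm x + cnorm y;
  cnormM : forall x y, cnorm (x * y) <= cnorm x * cnorm y;
  cnorm_star : forall x, cnorm (star x * x) = cnorm x ^+ 2;
  cnorm_complete : forall u : nat -> A,
    (forall e : C, 0 < e ->
      \forall m & n \near \oo, cnorm (u m - u n) < e) ->
    exists l, forall e : C, 0 < e -> \forall n \near \oo, cnorm (u n - l) < e
}.
(* The inverse that [Falgebra] adds to a finite dimensional algebra is
   determined by the multiplication, so it is no extra datum. *)
#[short(type="fdCStarAlgType")]
HB.structure Definition FDCStarAlgebra (C : numClosedFieldType) :=
  {A of StarAlgebra C A & isCStar C A & Falgebra C A}.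

HB.mixin Record isWeakHopf (C : numClosedFieldType) A
    of FDCStarAlgebra C A := {
  Delta : {linear A -> tens A A};
  counit : {scalar A};
  antipode : {linear A -> A};
  DeltaM : forall x y, Delta (x * y) = Delta x * Delta y;
  Delta_star : forall x, Delta (star x) = tmap star star (Delta x);
  Delta_coassoc : forall x,
    tmap Delta id (Delta x) = tassoc (tmap id Delta (Delta x));
  Delta1 : (Delta 1 ⊗ 1) * tassoc (1 ⊗ Delta 1) = tmap Delta id (Delta 1);
  counit_l : forall x, tlift (fun x1 x2 => counit x1 *: x2) (Delta x) = x;
  counit_r : forall x, tlift (fun x1 x2 => counit x2 *: x1) (Delta x) = x;
  counit_weakM : forall x y z,
    counit (x * y * z)
    = tlift (fun y1 y2 => counit (x * y1) * counit (y2 * z)) (Delta y);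
  antipode_l : forall x,
    tlift (fun x1 x2 => antipode x1 * x2) (Delta x)
    = tlift (fun u1 u2 => counit (x * u2) *: u1) (Delta 1);
  antipode_r : forall x,
    tlift (fun x1 x2 => x1 * antipode x2) (Delta x)
    = tlift (fun u1 u2 => counit (u1 * x) *: u2) (Delta 1);
  antipode_lr : forall x,
    tlift (fun x12 x3 =>
             tlift (fun x1 x2 => antipode x1 * x2 * antipode x3) x12)
      (tmap Delta id (Delta x))
    = antipode x
}.
#[short(type="weakHopfCStarType")]
HB.structure Definition WeakHopfCStar (C : numClosedFieldType) :=
  {A of FDCStarAlgebra C A & isWeakHopf C A}.

Arguments Delta {C A} : rename.
Arguments counit {C A} : rename.
Arguments antipode {C A} : rename.

Section Dual.
Variables (C : numClosedFieldType) (A : weakHopfCStarType C).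

Definition starl (x : A) : A := star (antipode x).

Definition dual : Type := 'Hom(A, C^o).

HB.instance Definition _ := Vector.on dual.

Definition pairing (psi : dual) (x : A) : C := fun_of_lfun psi x.

(* The functional with values f, for f linear. *)
Definition dual_of (f : A -> C) : dual := linfun (f : A -> C^o).

Definition dmul (psi phi : dual) : dual :=
  dual_of (fun x =>
    tlift (fun x1 x2 => pairing psi x1 * pairing phi x2 : C^o) (Delta x)).

Definition dunit : dual := dual_of counit.

Definition dcounit (psi : dual) : C := pairing psi 1.

Definition dantipode (psi : dual) : dual :=
  dual_of (fun x => pairing psi (antipode x)).

Definition dstar (psi : dual) : dual :=
  dual_of (fun x => (pairing psi (starl x))^*).

(* sum over j of psi( . b_j) (x) b^j, for a basis (b_j) of A and its dual basis
   (b^j); see [dcomulE] and [pairing2_inj]. *)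
Definition dcomul (psi : dual) : tens dual dual :=
  \sum_(j < \dim {:A})
    dual_of (fun x => pairing psi (x * tbase j)) ⊗ dual_of (tcoord j).

Definition pairing2 (t : tens dual dual) (x y : A) : C :=
  tlift (fun psi phi => pairing psi x * pairing phi y : C^o) t.

Lemma pairing_linear psi : linear (pairing psi : A -> C^o).
Proof. by move=> k x y; rewrite /pairing linearP. Qed.

Lemma dual_ofE (f : A -> C) x :
  linear (f : A -> C^o) -> pairing (dual_of f) x = f x.
Proof.
move=> fl; pose F : {linear A -> C^o} :=
  HB.pack (f : A -> C^o) (GRing.isLinear.Build C A C^o _ (f : A -> C^o) fl).
exact: (lfunE F).
Qed.

Lemma dualP (psi phi : dual) : pairing psi =1 pairing phi <-> psi = phi.
Proof. by split=> [e|-> //]; apply/lfunP. Qed.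

Lemma pairingD psi phi x : pairing (psi + phi) x = pairing psi x + pairing phi x.
Proof. exact: add_lfunE. Qed.

Lemma pairingZ k psi x : pairing (k *: psi) x = k * pairing psi x.
Proof. exact: scale_lfunE. Qed.

Lemma prod_bilin (V W : lmodType C) (f : V -> C) (g : W -> C) :
  linear (f : V -> C^o) -> linear (g : W -> C^o) ->
  bilin (fun v w => f v * g w : C^o).
Proof.
move=> fl gl; split=> [w k v v'|v k w w'] /=.
  by rewrite [f _]fl mulrDl -mulrA.
by rewrite [g _]gl mulrDr [X in X + _]mulrCA.
Qed.

Lemma tlift_Delta_linear (U : lmodType C) (f : A -> A -> U) :
  bilin f -> linear (fun x => tlift f (Delta x)).
Proof. by move=> fb k x y; rewrite linearP (tlift_linear fb). Qed.

Lemma dmulE psi phi x :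
  pairing (dmul psi phi) x
  = tlift (fun x1 x2 => pairing psi x1 * pairing phi x2 : C^o) (Delta x).
Proof.
by rewrite dual_ofE //; apply/tlift_Delta_linear/prod_bilin;
  apply: pairing_linear.
Qed.

Lemma dunitE x : pairing dunit x = counit x.
Proof. by rewrite dual_ofE // => k u v; rewrite linearP. Qed.

Fact dmulA : associative dmul.
Proof.
move=> f g h; apply/dualP => x; rewrite !dmulE.
pose P2 := tlift (fun x1 x2 => pairing f x1 * pairing g x2 : C^o).
have P2l : linear P2.
  by apply/tlift_linear/prod_bilin; apply: pairing_linear.
have P3 := prod_bilin P2l (pairing_linear h).
have := congr1 (tlift (fun y x3 => P2 y * pairing h x3 : C^o)) (Delta_coassoc x).
rewrite tlift_tmap // tlift_tassoc // => e.
transitivity (tlift (fun v w => P2 (Delta v) * pairing h w : C^o) (Delta x)).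
  rewrite e /tmap.
  pose Q v (t : tens A A) : C^o :=
    pairing f v * tlift (fun w u => pairing g w * pairing h u : C^o) t.
  have gh := prod_bilin (pairing_linear g) (pairing_linear h).
  have Qb : bilin Q.
    exact: (prod_bilin (pairing_linear f) (tlift_linear gh)).
  have QE v t : tlift (fun w u => P2 (v ⊗ w) * pairing h u : C^o) t = Q v t.
    rewrite /Q /tlift mulr_sumr; apply: eq_bigr => i _.
    rewrite /P2 tlift_pure ?mulrA //.
    by apply: prod_bilin; apply: pairing_linear.
  transitivity (tlift Q (tmap id Delta (Delta x))).
    rewrite tlift_tmap //; apply: eq_bigr => i _; by rewrite dmulE.
  by apply: eq_bigr => i _; rewrite QE.
by apply: eq_bigr => i _; rewrite dmulE.
Qed.

Fact dmul1 : left_id dunit dmul.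
Proof.
move=> f; apply/dualP => x; rewrite dmulE -[in RHS](counit_l x).
rewrite (lin_tlift _ _ (pairing_linear f)); apply: eq_bigr => i _.
by rewrite dunitE /pairing linearZ.
Qed.

Fact d1mul : right_id dunit dmul.
Proof.
move=> f; apply/dualP => x; rewrite dmulE -[in RHS](counit_r x).
rewrite (lin_tlift _ _ (pairing_linear f)); apply: eq_bigr => i _.
by rewrite dunitE /pairing linearZ mulrC.
Qed.

Fact dmulDl : left_distributive dmul +%R.
Proof.
move=> f g h; apply/dualP => x; rewrite pairingD !dmulE /tlift -big_split.
by apply: eq_bigr => i _; rewrite pairingD mulrDl.
Qed.

Fact dmulDr : right_distributive dmul +%R.
Proof.
move=> f g h; apply/dualP => x; rewrite pairingD !dmulE /tlift -big_split.
by apply: eq_bigr => i _; rewrite pairingD mulrDr.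
Qed.

Fact dunit_neq0 : dunit != 0.
Proof.
apply/eqP => /dualP e0; have /eqP[] := oner_neq0 A.
rewrite -(counit_l 1) [LHS]big1 // => i _.
by rewrite -dunitE e0 /pairing zero_lfunE scale0r.
Qed.

HB.instance Definition _ := GRing.Zmodule_isNzRing.Build dual
  dmulA dmul1 d1mul dmulDl dmulDr dunit_neq0.

Fact dscaleAl (k : C) (f g : dual) : k *: (f * g) = (k *: f) * g.
Proof.
apply/dualP => x; rewrite pairingZ !dmulE /tlift mulr_sumr.
by apply: eq_bigr => i _; rewrite pairingZ mulrA.
Qed.

Fact dscaleAr (k : C) (f g : dual) : k *: (f * g) = f * (k *: g).
Proof.
apply/dualP => x; rewrite pairingZ !dmulE /tlift mulr_sumr.
by apply: eq_bigr => i _; rewrite pairingZ mulrCA.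
Qed.

HB.instance Definition _ := GRing.Lmodule_isLalgebra.Build C dual dscaleAl.
HB.instance Definition _ := GRing.Lalgebra_isAlgebra.Build C dual dscaleAr.
HB.instance Definition _ := Algebra_isFalgebra.Build C dual.

Lemma dantipodeE psi x : pairing (dantipode psi) x = pairing psi (antipode x).
Proof. by rewrite dual_ofE // => k u v; rewrite linearP [LHS]pairing_linear. Qed.

Lemma dstarE psi x : pairing (dstar psi) x = (pairing psi (starl x))^*.
Proof.
rewrite dual_ofE // => k u v; rewrite /starl linearP starD starZ.
rewrite [pairing _ _]pairing_linear rmorphD /= [X in X + _]rmorphM /=.
by rewrite conjCK.
Qed.

Lemma dcomulE psi x y : pairing2 (dcomul psi) x y = pairing psi (x * y).
Proof.
pose P := fun s t : dual => pairing s x * pairing t y : C^o.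
have Pb : bilin P.
  by apply: prod_bilin => k s t; rewrite pairingD pairingZ.
have Pl := tlift_linear Pb.
pose F : {linear tens dual dual -> C^o} :=
  HB.pack (tlift P) (GRing.isLinear.Build C _ C^o _ (tlift P) Pl).
rewrite -[LHS]/(F (dcomul psi)) linear_sum /= [in RHS](tbase_sum y) mulr_sumr.
rewrite /pairing linear_sum; apply: eq_bigr => j _.
have el : linear (fun x => pairing psi (x * tbase j) : C^o).
  by move=> k u v; rewrite mulrDl -scalerAl [LHS]pairing_linear.
rewrite tlift_pure // /P !dual_ofE //; last by move=> k u v; rewrite /tcoord linearP.
by rewrite -scalerAr linearZ mulrC.
Qed.

Lemma pairing2_inj s t : (forall x y, pairing2 s x y = pairing2 t x y) -> s = t.
Proof.
move=> e; apply/ffunP => i; apply/dualP => x.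
have E (u : tens dual dual) y :
  pairing2 u x y = pairing (\sum_j pairing (u j) x *: tbase j) y.
  rewrite /pairing sum_lfunE; apply: eq_bigr => j _.
  by rewrite scale_lfunE.
have /dualP : pairing (\sum_j pairing (s j) x *: tbase j)
           =1 pairing (\sum_j pairing (t j) x *: tbase j).
  by move=> y; rewrite -!E.
move/(congr1 (tcoord i)); rewrite /tcoord /tbase !coord_sum_free //;
  exact: basis_free (vbasisP _).
Qed.

End Dual.

Arguments pairing {C A}.
Arguments dcomul {C A}.
Arguments dcounit {C A}.
Arguments dstar {C A}.

Section Correspondence.
Variables (C : numClosedFieldType) (A : weakHopfCStarType C).
Variable M : starAlgType C.

Record module_algebra_action (act : A -> M -> M) : Prop := {
  act_bilin : bilin act;
  act_mul : forall a b m, act (a * b) m = act a (act b m);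
  act_one : forall m, act 1 m = m;
  act_mulr : forall a m n,
    act a (m * n) = tlift (fun a1 a2 => act a1 m * act a2 n) (Delta a);
  act_star : forall a m, star (act a m) = act (starl a) (star m);
  act_unit : forall a,
    act a 1 = act (tlift (fun a1 a2 => a1 * antipode a2) (Delta a)) 1
}.

(* M (x) dual (x) dual is read as (M (x) dual) (x) dual. *)
Record comodule_algebra_coaction (rho : M -> tens M (dual A)) : Prop := {
  coact_linear : linear rho;
  coact_mul : forall m n, rho (m * n) = rho m * rho n;
  coact_star : forall m, rho (star m) = tmap star dstar (rho m);
  coact_coassoc : forall m,
    tmap rho id (rho m) = tassoc (tmap id dcomul (rho m));
  coact_counit : forall m,
    tlift (fun n psi => dcounit psi *: n) (rho m) = m;
  coact_unit :
    tassoc ((1 : M) ⊗ dcomul (1 : dual A)) * (rho 1 ⊗ (1 : dual A))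
    = tassoc (tmap id dcomul (rho 1))
}.

(* (id (x) a)(t), a being the functional psi |-> <psi, a> on the dual. *)
Definition slice (a : A) (t : tens M (dual A)) : M :=
  tlift (fun m psi => pairing psi a *: m) t.

End Correspondence.

(* M acting, through the faithful unital *-representation pi, as a von Neumann
   algebra on the Hilbert space H, that is, with pi(M)'' = pi(M). *)
Section VonNeumann.
Variables (C : numClosedFieldType) (M : starAlgType C).
Variables (H : completeNormedModType C) (dot : {dot H for (@Num.conj C)}).
Variable pi : M -> H -> H.

Definition bounded_op (T : H -> H) : Prop := linear T /\ continuous T.

Record von_neumann_algebra : Prop := {
  vn_hilbert : forall h, `|h| ^+ 2 = dot h h;
  vn_bounded : forall x, bounded_op (pi x);
  vn_linear : forall k x y h, pi (k *: x + y) h = k *: pi x h + pi y h;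
  vn_mul : forall x y h, pi (x * y) h = pi x (pi y h);
  vn_one : forall h, pi 1 h = h;
  vn_star : forall x h h', dot (pi (star x) h) h' = dot h (pi x h');
  vn_faithful : forall x, (forall h, pi x h = 0) -> x = 0;
  vn_bicommutant : forall T, bounded_op T ->
    (forall S, bounded_op S -> (forall x, S \o pi x = pi x \o S) ->
       S \o T = T \o S) ->
    exists x, pi x = T
}.

(* Convergence in the weak operator topology of M. *)
Definition weak_cvg (F : set_system M) (m : M) : Prop :=
  forall h h', dot (pi x h) h' @[x --> F] --> (dot (pi m h) h' : C).

(* The corresponding convergence on M (x) B, B finite dimensional: all the
   functionals w (x) phi, with w a matrix coefficient of pi, converge. *)
Definition tens_weak_cvg (B : vectType C) (F : set_system (tens M B))
    (t : tens M B) : Prop :=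
  forall phi : {scalar B},
    weak_cvg (tlift (fun m b => phi b *: m) s @[s --> F])
             (tlift (fun m b => phi b *: m) t).

Definition weakly_continuous (f : M -> M) : Prop :=
  forall (F : set_system M) m, ProperFilter F ->
    weak_cvg F m -> weak_cvg (f @ F) (f m).

Definition tens_weakly_continuous (B : vectType C) (f : M -> tens M B) : Prop :=
  forall (F : set_system M) m, ProperFilter F ->
    weak_cvg F m -> tens_weak_cvg (f @ F) (f m).

End VonNeumann.

(* Main.v *)
(* Slicing by the elements of [A], regarded as functionals on the dual, is
   jointly injective and, with dual bases, invertible, so a linear [rho] amounts
   to a bilinear [act], and each coaction axiom can be tested on slices.
   Multiplicativity, coassociativity and counitality become the module algebra
   axioms verbatim. The unit axiom becomes
   [act (ab) 1 = e(a_(1) b) act a_(2) 1], which is equivalent to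
   [act a 1 = act (a_(1) S(a_(2))) 1] by the identity
   [a * target b = e(a_(1) b) a_(2)], where [target b = b_(1) S(b_(2))].
   The two * axioms match because [x |-> S(x)^*] is an involution: this is
   [star \o S \o star = S^-1], which follows from the antimultiplicativity of
   [S] and the uniqueness of convolution quasi-inverses. *)
From HB Require Import structures.
Require Import Defs.
From mathcomp Require Import all_boot all_order all_algebra falgebra complex.
From mathcomp Require Import all_classical all_reals topology normedtype.
Set Implicit Arguments.
Unset Strict Implicit.
Unset Printing Implicit Defensive.
Import GRing.Theory Num.Theory.

Local Open Scope classical_set_scope.
Local Open Scope ring_scope.

(** A constant of its own for [linear], which gives the tactic [lin] a fixed head to match. *)
Definition lin (K : fieldType) (U V : lmodType K) (f : U -> V) := linear f.

(** * Linear maps and induced maps on tensor products *)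

Section Linearity.
Variables (K : fieldType).
Implicit Types U V W X : lmodType K.

Lemma lin_id U : lin (fun x : U => x). Proof. by []. Qed.

Lemma lin_fun U V W (g : {linear V -> W}) (f : U -> V) :
  lin f -> lin (fun x => g (f x)).
Proof. by move=> fl k u v; rewrite fl linearP. Qed.

Lemma lin_mull U (A : algType K) (f : U -> A) c :
  lin f -> lin (fun x => f x * c).
Proof. by move=> fl k x y; rewrite fl mulrDl -scalerAl. Qed.

Lemma lin_mulr U (A : algType K) (f : U -> A) c :
  lin f -> lin (fun x => c * f x).
Proof. by move=> fl k x y; rewrite fl mulrDr -scalerAr. Qed.

Lemma lin_scalel U V (f : U -> K^o) (v : V) :
  lin f -> lin (fun x => f x *: v).
Proof. by move=> fl k x y; rewrite fl scalerDl scalerA. Qed.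

Lemma lin_scaler U V (f : U -> V) (c : K) :
  lin f -> lin (fun x => c *: f x).
Proof. by move=> fl k x y; rewrite fl scalerDr !scalerA mulrC. Qed.

Lemma lin_tliftl U V (W : vectType K) X (f : U -> V -> W -> X) t :
  (forall v w, lin (fun x => f x v w)) -> lin (fun x => tlift (f x) t).
Proof.
move=> fl k x y; rewrite /tlift scaler_sumr -big_split /=.
by apply: eq_bigr => i _; rewrite fl.
Qed.

Lemma bilinP V W U (f : V -> W -> U) :
  (forall w, lin (fun v => f v w)) -> (forall v, lin (fun w => f v w)) ->
  bilin f.
Proof. by []. Qed.

Lemma bilin_linl V W U (f : V -> W -> U) w : bilin f -> lin (fun v => f v w).
Proof. by case=> fl _; apply: fl. Qed.

Lemma bilin_linr V W U (f : V -> W -> U) v : bilin f -> lin (fun w => f v w).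
Proof. by case=> _; apply. Qed.

Lemma lin_comp U V W (g : V -> W) (f : U -> V) :
  lin g -> lin f -> lin (fun x => g (f x)).
Proof. by move=> gl fl k x y; rewrite fl gl. Qed.

Lemma lin_sum U V (f : U -> V) (I : finType) (F : I -> U) :
  lin f -> f (\sum_i F i) = \sum_i f (F i).
Proof.
move=> fl; pose G : {linear U -> V} := HB.pack f (GRing.isLinear.Build K U V _ f fl).
exact: (linear_sum G).
Qed.

Lemma linZ U V (f : U -> V) k x : lin f -> f (k *: x) = k *: f x.
Proof.
move=> fl; pose G : {linear U -> V} := HB.pack f (GRing.isLinear.Build K U V _ f fl).
exact: (linearZZ G).
Qed.

Lemma eq_tlift V (W : vectType K) (X : nmodType) (f g : V -> W -> X) t :
  f =2 g -> tlift f t = tlift g t.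
Proof. by move=> fg; apply: eq_bigr => i _. Qed.

Lemma tlift_exchange V (W : vectType K) V' (W' : vectType K) (X : nmodType)
    (f : V -> W -> V' -> W' -> X) t t' :
  tlift (fun v w => tlift (f v w) t') t
  = tlift (fun v' w' => tlift (fun v w => f v w v' w') t) t'.
Proof. exact: exchange_big. Qed.

End Linearity.

Lemma star_tlift (C : numClosedFieldType) (B : starAlgType C) (V : lmodType C)
    (W : vectType C) (f : V -> W -> B) t :
  star (tlift f t) = tlift (fun v w => star (f v w)) t.
Proof.
apply: (big_morph star); first exact: starD.
by rewrite -[0 in LHS](scale0r 0) starZ conjC0 scale0r.
Qed.

(** * Sweedler sums and their linearity *)

Section Sweedler.
Variables (C : numClosedFieldType) (A : weakHopfCStarType C).
Implicit Types (x y z : A) (U V : lmodType C).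

(* [\S_(a, b | x) E] is the Sweedler expression E(x_(1), x_(2)). *)
Definition sw (U : nmodType) (f : A -> A -> U) x := tlift f (Delta x).

Local Notation "'\S_' ( a , b | x ) E" := (sw (fun a b => E) x)
  (at level 41, a name, b name, E at level 41).

Lemma sw_lin V U (f : A -> A -> U) (g : V -> A) :
  bilin f -> lin g -> lin (fun v => sw f (g v)).
Proof. by move=> fb gl k u v; rewrite /sw gl linearP (tlift_linear fb). Qed.

Lemma lin_sw V U (f : V -> A -> A -> U) y :
  (forall a b, lin (fun v => f v a b)) -> lin (fun v => sw (f v) y).
Proof. exact: lin_tliftl. Qed.

Lemma lin_counit V (f : V -> A) : lin f -> lin ((fun v => counit (f v)) : V -> C^o).
Proof. by move=> fl k u v; rewrite fl linearP. Qed.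

Lemma lin_antipode V (f : V -> A) : lin f -> lin (fun v => antipode (f v)).
Proof. exact: lin_fun. Qed.

Lemma lin_conj_star (f : A -> C^o) :
  lin f -> lin ((fun x => (f (star x))^*) : A -> C^o).
Proof.
move=> fl k x y; rewrite starD starZ fl rmorphD; congr (_ + _).
by rewrite -[LHS]/((k^* * f (star x))^*) rmorphM /= conjCK.
Qed.

Lemma lin_star_star (f : A -> A) : lin f -> lin (fun x => star (f (star x))).
Proof. by move=> fl k x y; rewrite starD starZ fl starD starZ conjCK. Qed.

End Sweedler.

(** * Trilinear maps and automation of linearity goals *)

Definition trilin (K : fieldType) (V W X U : lmodType K) (f : V -> W -> X -> U) :=
  [/\ forall b c, lin (fun a => f a b c), forall a c, lin (fun b => f a b c)
    & forall a b, lin (fun c => f a b c)].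

Lemma trilin1 (K : fieldType) (V W X U : lmodType K) (f : V -> W -> X -> U) b c :
  trilin f -> lin (fun a => f a b c).
Proof. by case. Qed.

Lemma trilin2 (K : fieldType) (V W X U : lmodType K) (f : V -> W -> X -> U) a c :
  trilin f -> lin (fun b => f a b c).
Proof. by case. Qed.

Lemma trilin3 (K : fieldType) (V W X U : lmodType K) (f : V -> W -> X -> U) a b :
  trilin f -> lin (fun c => f a b c).
Proof. by case. Qed.

(* The patterns [fun _ => ?d] test that an argument does not depend on the
   variable. *)
Ltac lin :=
  match goal with
  | |- forall _, _ => intro; lin
  | |- trilin _ => split; intros ? ?; lin
  | |- bilin _ => apply: bilinP; intro; lin
  | |- linear ?f => change (lin f); lin
  | |- _ => solve [apply: lin_id | assumption | exact: (lin_antipode (@lin_id _ _))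
      | exact: (lin_counit (@lin_id _ _))
      | exact: (lin_mulr _ (@lin_id _ _)) | exact: (lin_scaler _ (@lin_id _ _))
      | exact: bilin_linl | exact: bilin_linr
      | exact: trilin1 | exact: trilin2 | exact: trilin3]
  | |- lin (fun x => @?c x * @?f x) =>
      lazymatch c with
      | fun _ => ?d => apply: lin_mulr; lin
      | _ => apply: lin_mull; lin
      end
  | |- lin (fun x => @?c x *: @?f x) =>
      lazymatch c with
      | fun _ => ?d => apply: lin_scaler; lin
      | _ => apply: lin_scalel; lin
      end
  | |- lin (fun x => sw (@?f x) (@?g x)) =>
      lazymatch f with
      | fun _ => ?d => apply: sw_lin; lin
      | _ => apply: lin_sw; lin
      end
  | |- lin (fun x => GRing.Linear.sort _ (@?g x)) =>
      first [apply: lin_counit | apply: lin_antipode]; lin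
  | H : lin ?f |- lin (fun x => ?f (@?g x)) => apply: (lin_comp (f := g) H); lin
  | H : bilin ?f |- lin (fun x => ?f (@?g x) (@?h x)) =>
      lazymatch g with
      | fun _ => ?d => apply: (lin_comp (f := h) (bilin_linr _ H)); lin
      | _ => apply: (lin_comp (f := g) (bilin_linl _ H)); lin
      end
  | H : trilin ?f |- lin (fun x => ?f (@?g x) (@?h x) (@?k x)) =>
      lazymatch g with
      | fun _ => ?d => lazymatch h with
        | fun _ => ?d => apply: (lin_comp (f := k) (trilin3 _ _ H)); lin
        | _ => apply: (lin_comp (f := h) (trilin2 _ _ H)); lin
        end
      | _ => apply: (lin_comp (f := g) (trilin1 _ _ H)); lin
      end
  end.

(** * Sweedler calculus: coproduct, star, counit and counital maps *)

Section SweedlerRules.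
Variables (C : numClosedFieldType) (A : weakHopfCStarType C).
Implicit Types (x y z : A) (U V : lmodType C).

Local Notation "'\S_' ( a , b | x ) E" := (sw (fun a b => E) x)
  (at level 41, a name, b name, E at level 41).

Lemma eq_sw (U : nmodType) (f g : A -> A -> U) x : f =2 g -> sw f x = sw g x.
Proof. exact: eq_tlift. Qed.

Lemma sw_exchange (U : nmodType) (f : A -> A -> A -> A -> U) x y :
  \S_(x1, x2 | x) \S_(y1, y2 | y) f x1 x2 y1 y2
  = \S_(y1, y2 | y) \S_(x1, x2 | x) f x1 x2 y1 y2.
Proof. exact: tlift_exchange. Qed.

Lemma lin_of_sw U V (L : U -> V) (f : A -> A -> U) x :
  lin L -> L (\S_(a, b | x) f a b) = \S_(a, b | x) L (f a b).
Proof. exact: lin_tlift. Qed.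

Lemma tlift_tens_mul (V : algType C) (W : falgType C) U (f : V -> W -> U) s t :
  bilin f ->
  tlift f (s * t)
  = tlift (fun v w => tlift (fun v' w' => f (v * v') (w * w')) t) s.
Proof.
move=> fb; rewrite -[s * t]/(tens_mul s t) /tens_mul.
rewrite (lin_tlift _ _ (tlift_linear fb)); apply: eq_tlift => v w.
rewrite (lin_tlift _ _ (tlift_linear fb)); apply: eq_tlift => v' w'.
by rewrite tlift_pure.
Qed.

Lemma tlift_pure_mul (V : algType C) (W : falgType C) U (f : V -> W -> U) v w t :
  bilin f ->
  tlift f ((v ⊗ w) * t) = tlift (fun v' w' => f (v * v') (w * w')) t.
Proof.
move=> fb; rewrite [in LHS](tens_sum t) mulr_sumr (lin_sum _ (tlift_linear fb)).
apply: eq_bigr => i _.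
by rewrite -[X in tlift f X]/(tens_mul _ _) tens_mul_pure tlift_pure.
Qed.

Lemma tlift_mul_pure (V : algType C) (W : falgType C) U (f : V -> W -> U) v w t :
  bilin f ->
  tlift f (t * (v ⊗ w)) = tlift (fun v' w' => f (v' * v) (w' * w)) t.
Proof.
move=> fb; rewrite [in LHS](tens_sum t) mulr_suml (lin_sum _ (tlift_linear fb)).
apply: eq_bigr => i _.
by rewrite -[X in tlift f X]/(tens_mul _ _) tens_mul_pure tlift_pure.
Qed.

Lemma sw_mul U (f : A -> A -> U) x y : bilin f ->
  sw f (x * y) = \S_(x1, x2 | x) \S_(y1, y2 | y) f (x1 * y1) (x2 * y2).
Proof. by move=> fb; rewrite /sw DeltaM tlift_tens_mul. Qed.

Lemma trilin_bilin12 (V W X : vectType C) U (f : V -> W -> X -> U) c :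
  trilin f -> bilin (fun a b => f a b c).
Proof. by case=> f1 f2 f3; lin. Qed.

(** The laws [Delta_coassoc] and [Delta1] are equations in (A ⊗ A) ⊗ A; a trilinear map is evaluated
    on them in this form. *)
Lemma trilin_lift (V W X : vectType C) U (f : V -> W -> X -> U) :
  trilin f -> bilin (fun ab c => tlift (fun a b => f a b c) ab).
Proof.
move=> ft; split=> [c|ab].
  by apply: tlift_linear; apply: trilin_bilin12.
by apply: lin_tliftl => a b; have [_ _] := ft; apply.
Qed.

Lemma sw_coassoc U (f : A -> A -> A -> U) x : trilin f ->
  \S_(y, c | x) \S_(a, b | y) f a b c = \S_(a, y | x) \S_(b, c | y) f a b c.
Proof.
move=> ft; have Fb := trilin_lift ft.
have := congr1 (tlift (fun ab c => tlift (fun a b => f a b c) ab)) (Delta_coassoc x).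
rewrite tlift_tmap // tlift_tassoc // => e.
rewrite -[LHS]/(tlift (fun v w => tlift (fun a b => f a b w) (Delta v)) (Delta x)).
rewrite e tlift_tmap; last first.
  split=> [t|v] /=.
    apply: lin_tliftl => b c k a a'; rewrite (pure_bilin _ _).1.
    exact: (Fb.1 c).
  apply: tlift_linear; split=> [w k b b'|w k b b']; last exact: (Fb.2 _).
  by rewrite (pure_bilin _ _).2; apply: (Fb.1 w).
apply: eq_sw => a y; apply: eq_sw => b c.
by rewrite tlift_pure //; apply: trilin_bilin12.
Qed.

Lemma sw_Delta1 U (f : A -> A -> A -> U) : trilin f ->
  \S_(u1, u2 | 1) \S_(v1, v2 | 1) f u1 (u2 * v1) v2
  = \S_(y, c | 1) \S_(a, b | y) f a b c.
Proof.
move=> ft; have Fb := trilin_lift ft.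
have := congr1 (tlift (fun ab c => tlift (fun a b => f a b c) ab)) (@Delta1 C A).
rewrite [in RHS]tlift_tmap // tlift_pure_mul // tlift_tassoc; last first.
  split=> [c|ab]; first exact: (lin_comp (Fb.1 _) (lin_mulr _ (@lin_id _ _))).
  exact: (lin_comp (Fb.2 _) (lin_mulr _ (@lin_id _ _))).
rewrite tlift_pure; last first.
  split=> [t|v].
    apply: lin_tliftl => b c; apply: (lin_comp (Fb.1 _)); apply: lin_mulr.
    exact: (pure_bilin _ _).1.
  apply: tlift_linear; split=> [c|b]; last first.
    exact: (lin_comp (Fb.2 _) (lin_mulr _ (@lin_id _ _))).
  apply: (lin_comp (Fb.1 _)); apply: lin_mulr; exact: (pure_bilin _ _).2.
apply: etrans; rewrite sw_exchange; apply: eq_sw => v1 v2.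
rewrite tlift_mul_pure; last exact: trilin_bilin12.
by apply: eq_sw => u1 u2; rewrite mulr1 mul1r.
Qed.

Lemma sw_star U (f : A -> A -> U) x : bilin f ->
  sw f (star x) = \S_(a, b | x) f (star a) (star b).
Proof. by move=> fb; rewrite /sw Delta_star tlift_tmap. Qed.

Lemma star1 : star (1 : A) = 1.
Proof.
by rewrite -[RHS]starK -[star 1 in RHS]mulr1 starM starK mulr1.
Qed.

Lemma star_sw (f : A -> A -> A) x :
  star (sw f x) = \S_(a, b | x) star (f a b).
Proof. exact: star_tlift. Qed.

Lemma conj_sw (f : A -> A -> C) x :
  (sw f x)^* = \S_(a, b | x) (f a b)^*.
Proof. exact: (big_morph Num.conj (rmorphD _) (rmorph0 _)). Qed.

Lemma sw_counitl U (f : A -> U) x :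
  lin f -> \S_(a, b | x) counit a *: f b = f x.
Proof.
move=> fl; rewrite -[in RHS](counit_l x) (lin_of_sw _ _ fl).
by apply: eq_sw => a b; rewrite (linZ _ _ fl).
Qed.

(* The conjugate of [counit \o star] is also a counit, and counits are unique. *)
Lemma counit_star x : counit (star x) = (counit x)^*.
Proof.
have el : lin ((fun x => (counit (star x))^* ) : A -> C^o).
  exact: lin_conj_star (lin_counit (@lin_id _ _)).
rewrite -[LHS]conjCK; congr (_^* ).
rewrite -[x in LHS]counit_r.
rewrite (lin_of_sw (L := (fun x => (counit (star x))^* ) : A -> C^o) _ _ el).
(* With e' the conjugate of [counit \o star], the sum of e'(x_(1)) counit(x_(2)) is e'(x) as
   [counit] is a right counit; what remains is that it is also counit(x), as e' is a left counit. *)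
transitivity (sw (fun a b => counit (((counit (star a))^*) *: b)) x).
  by apply: eq_sw => a b; rewrite (linZ _ _ el) linearZ /= mulrC.
rewrite -(lin_of_sw (L := counit : A -> C^o) _ _ (lin_counit (@lin_id _ _))).
apply: (congr1 counit); rewrite -[RHS]starK -[star x in RHS]counit_l.
rewrite -[X in star X]/(sw _ _) sw_star; last by lin.
by rewrite star_sw; apply: eq_sw => a b; rewrite starZ starK.
Qed.

(** Conjugating [counit_weakM] by the star reverses the products but keeps the order of the legs of
    [Delta y], so the legs end up swapped. *)
Lemma counit_mulC x y z :
  counit (x * y * z) = \S_(a, b | y) counit (x * b) * counit (a * z).
Proof.
rewrite -[LHS]conjCK -counit_star !starM mulrA counit_weakM.
rewrite -[X in X^*]/(sw (fun a b => (counit _ * counit _ : C^o)) _).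
rewrite sw_star; last by lin.
rewrite conj_sw; apply: eq_sw => a b.
by rewrite -!starM !counit_star rmorphM /= !conjCK mulrC.
Qed.

(** The factors of [Delta1] commute: their product is the iterated coproduct of 1, which the star
    fixes, while it reverses the product. *)
Lemma sw_Delta1_rev (f : A -> A -> A -> A) : trilin f ->
  \S_(u1, u2 | 1) \S_(v1, v2 | 1) f u1 (v1 * u2) v2
  = \S_(u1, u2 | 1) \S_(v1, v2 | 1) f u1 (u2 * v1) v2.
Proof.
move=> ft; rewrite [RHS]sw_Delta1 //.
(* Conjugation by the star in every slot keeps [f] trilinear, so [sw_Delta1] applies to [g]. *)
pose g a b c := star (f (star a) (star b) (star c)).
have gt : trilin g.
  by case: ft => f1 f2 f3; split=> a b;
    [exact: (lin_star_star (f1 _ _)) | exact: (lin_star_star (f2 _ _))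
    | exact: (lin_star_star (f3 _ _))].
have Fb := trilin_lift ft; have [f1 f2 f3] := ft.
transitivity (star (\S_(y, c | 1) \S_(a, b | y) g a b c)).
  rewrite -sw_Delta1 // star_sw -[X in sw _ X = _]star1 sw_star; last by lin.
  apply: eq_sw => u1 u2.
  rewrite star_sw -[X in sw _ X = _]star1 sw_star; last by lin.
  by apply: eq_sw => v1 v2; rewrite /g starK starM.
rewrite star_sw -[X in _ = sw _ X]star1 sw_star; last by lin.
apply: eq_sw => y c; rewrite sw_star; last by lin.
by rewrite star_sw; apply: eq_sw => a b; rewrite /g starK.
Qed.

(* The elements [g(1_(1)) 1_(2)] and [1_(1) g(1_(2))], for [g] linear, are those
   of the two counital subalgebras. *)
Definition left_base (g : A -> C^o) : A := \S_(u1, u2 | 1) g u1 *: u2.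
Definition right_base (g : A -> C^o) : A := \S_(u1, u2 | 1) g u2 *: u1.

(** For l in the left base, [Delta l = Delta 1 * (l ⊗ 1)], and [Delta x * Delta 1 = Delta x] absorbs
    the first factor. *)
Lemma sw_mul_left_base (f : A -> A -> A) g x : bilin f -> lin g ->
  sw f (x * left_base g) = \S_(x1, x2 | x) f (x1 * left_base g) x2.
Proof.
move=> fb gl; pose h a b c := g a *: \S_(x1, x2 | x) f (x1 * b) (x2 * c).
have ht : trilin h by rewrite /h; lin.
have sl : lin (fun y => sw f (x * y)) by lin.
rewrite [in LHS]/left_base (lin_of_sw _ _ sl).
transitivity (\S_(u1, y | 1) \S_(v1, v2 | y) h u1 v1 v2).
  apply: eq_sw => u1 y; rewrite (linZ _ _ sl) sw_mul // sw_exchange.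
  by rewrite (lin_of_sw _ _ (lin_scaler _ (@lin_id _ _))).
(* The reversed order puts the second copy of [Delta 1] next to [Delta x], where it is absorbed as
   [Delta (x * 1)]. *)
rewrite -sw_coassoc // -sw_Delta1 // -sw_Delta1_rev //.
transitivity (\S_(u1, u2 | 1) g u1 *: \S_(x1, x2 | x) f (x1 * u2) x2).
  apply: eq_sw => u1 u2; rewrite -(lin_of_sw _ _ (lin_scaler _ (@lin_id _ _))).
  have fb2 : bilin (fun a b => f (a * u2) b) by lin.
  rewrite -[in RHS](mulr1 x) (sw_mul _ _ fb2) sw_exchange; congr (_ *: _).
  by apply: eq_sw => ? ?; apply: eq_sw => ? ?; rewrite mulrA.
under eq_sw => u1 u2 do rewrite (lin_of_sw _ _ (lin_scaler _ (@lin_id _ _))).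
rewrite sw_exchange; apply: eq_sw => x1 x2.
have fl2 : lin (fun z => f (x1 * z) x2) by lin.
by rewrite (lin_of_sw _ _ fl2); apply: eq_sw => ? ?; rewrite (linZ _ _ fl2).
Qed.

(** The mirror image: [Delta r = (1 ⊗ r) * Delta 1] for r in the right base. *)
Lemma sw_mul_right_base (f : A -> A -> A) g x : bilin f -> lin g ->
  sw f (right_base g * x) = \S_(x1, x2 | x) f x1 (right_base g * x2).
Proof.
move=> fb gl; pose h a b c := g c *: \S_(x1, x2 | x) f (a * x1) (b * x2).
have ht : trilin h by rewrite /h; lin.
have sl : lin (fun y => sw f (y * x)) by lin.
rewrite [in LHS]/right_base (lin_of_sw _ _ sl).
transitivity (\S_(y, v2 | 1) \S_(u1, v1 | y) h u1 v1 v2).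
  apply: eq_sw => y v2; rewrite (linZ _ _ sl) sw_mul //.
  by rewrite (lin_of_sw _ _ (lin_scaler _ (@lin_id _ _))).
rewrite -sw_Delta1 // -sw_Delta1_rev // sw_exchange.
transitivity (\S_(v1, v2 | 1) g v2 *: \S_(x1, x2 | x) f x1 (v1 * x2)).
  apply: eq_sw => v1 v2; rewrite -(lin_of_sw _ _ (lin_scaler _ (@lin_id _ _))).
  have fb2 : bilin (fun a b => f a (v1 * b)) by lin.
  rewrite -[in RHS](mul1r x) (sw_mul _ _ fb2); congr (_ *: _).
  by apply: eq_sw => ? ?; apply: eq_sw => ? ?; rewrite mulrA.
under eq_sw => u1 u2 do rewrite (lin_of_sw _ _ (lin_scaler _ (@lin_id _ _))).
rewrite sw_exchange; apply: eq_sw => x1 x2.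
have fl2 : lin (fun z => f x1 (z * x2)) by lin.
by rewrite (lin_of_sw _ _ fl2); apply: eq_sw => ? ?; rewrite (linZ _ _ fl2).
Qed.

(** The counital maps of weak Hopf algebra theory, usually written Pi^L and Pi^R. *)
Definition target x : A := left_base (fun a => counit (a * x)).
Definition source x : A := right_base (fun a => counit (x * a)).

Lemma lin_target : lin target. Proof. by rewrite /target /left_base; lin. Qed.
Lemma lin_source : lin source. Proof. by rewrite /source /right_base; lin. Qed.

Lemma mul_antipode x : \S_(a, b | x) a * antipode b = target x.
Proof. exact: antipode_r. Qed.

Lemma antipode_mul x : \S_(a, b | x) antipode a * b = source x.
Proof. exact: antipode_l. Qed.

(** Both products sum g(u1) h(v2) times the middle leg, u2 v1 or v1 u2, over two copies of
    [Delta 1]; by [sw_Delta1_rev] the order is immaterial. *)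
Lemma base_comm g h : lin g -> lin h ->
  left_base g * right_base h = right_base h * left_base g.
Proof.
move=> gl hl; rewrite /left_base /right_base.
pose k a b c : A := g a *: (h c *: b).
have kt : trilin k by rewrite /k; lin.
transitivity (\S_(u1, u2 | 1) \S_(v1, v2 | 1) k u1 (u2 * v1) v2).
  rewrite (lin_of_sw _ _ (lin_mull _ (@lin_id _ _))); apply: eq_sw => u1 u2.
  rewrite (lin_of_sw _ _ (lin_mulr _ (@lin_id _ _))); apply: eq_sw => v1 v2.
  by rewrite /k -scalerAl -scalerAr.
rewrite -sw_Delta1_rev //.
rewrite (lin_of_sw _ _ (lin_mulr _ (@lin_id _ _))); apply: eq_sw => u1 u2.
rewrite (lin_of_sw _ _ (lin_mull _ (@lin_id _ _))); apply: eq_sw => v1 v2.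
by rewrite /k -scalerAl -scalerAr !scalerA [h _ * _]mulrC.
Qed.

(** By [sw_mul_left_base] the left side is target(x target(y)), and [counit_mulC] with middle factor
    1 replaces target(y) by y under the counit. *)
Lemma target_mul x y : \S_(a, b | x) a * target y * antipode b = target (x * y).
Proof.
have cl : lin ((fun a => counit (a * y)) : A -> C^o) by lin.
rewrite -(sw_mul_left_base (f := fun a b => a * antipode b)) //; last by lin.
rewrite -[LHS]/(\S_(a, b | x * target y) a * antipode b) mul_antipode.
rewrite /target /left_base; apply: eq_sw => u1 u2; congr (_ *: _).
have -> : u1 * (x * y) = u1 * x * 1 * y by rewrite mulr1 mulrA.
rewrite [in RHS]counit_mulC [u1 * (x * _)]mulrA.
have el : lin ((fun z => counit (u1 * x * z)) : A -> C^o) by lin.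
rewrite (lin_of_sw _ _ el); apply: eq_sw => v1 v2.
by rewrite (linZ _ _ el) mulrC.
Qed.

(** The mirror image of [target_mul], through source(source(x) y). *)
Lemma mul_source x y : \S_(a, b | y) antipode a * (source x * b) = source (x * y).
Proof.
have cl : lin ((fun a => counit (x * a)) : A -> C^o) by lin.
rewrite -(sw_mul_right_base (f := fun a b => antipode a * b)) //; last by lin.
rewrite -[LHS]/(\S_(a, b | source x * y) antipode a * b) antipode_mul.
rewrite /source /right_base; apply: eq_sw => u1 u2; congr (_ *: _).
have -> : x * y * u2 = x * 1 * (y * u2) by rewrite mulr1 mulrA.
rewrite [in RHS]counit_mulC.
have el : lin ((fun z => counit (z * y * u2)) : A -> C^o) by lin.
rewrite (lin_of_sw _ _ el); apply: eq_sw => v1 v2.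
by rewrite (linZ _ _ el) mulrA.
Qed.

(** * Antimultiplicativity of the antipode *)

Lemma mulr_swr c (f : A -> A -> A) x :
  c * sw f x = \S_(a, b | x) c * f a b.
Proof. exact: (lin_of_sw _ _ (lin_mulr _ (@lin_id _ _))). Qed.

Lemma mulr_swl c (f : A -> A -> A) x :
  sw f x * c = \S_(a, b | x) f a b * c.
Proof. exact: (lin_of_sw _ _ (lin_mull _ (@lin_id _ _))). Qed.

Lemma source_antipode x : \S_(y, c | x) source y * antipode c = antipode x.
Proof.
rewrite -[RHS]antipode_lr tlift_tmap //; last by apply: trilin_lift; lin.
by apply: eq_sw => y c; rewrite -antipode_mul mulr_swl.
Qed.

Lemma antipode_target x : \S_(a, y | x) antipode a * target y = antipode x.
Proof.
rewrite -[RHS]source_antipode.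
transitivity (\S_(y, c | x) \S_(a, b | y) antipode a * (b * antipode c)).
  rewrite (sw_coassoc (f := fun a b c => antipode a * (b * antipode c)));
    last by lin.
  by apply: eq_sw => y c; rewrite -mul_antipode mulr_swr.
apply: eq_sw => y c; rewrite -antipode_mul mulr_swl.
by apply: eq_sw => a b; rewrite mulrA.
Qed.

(** Once [target] is expanded, this is (counit ⊗ id) applied to [Delta 1 * Delta x]. *)
Lemma target_mul_id x : \S_(y, c | x) target y * c = x.
Proof.
under eq_sw => y c do rewrite mulr_swl.
rewrite sw_exchange -[RHS](sw_counitl (f := id)) // -[in RHS](mul1r x).
rewrite sw_mul; last by lin.
by apply: eq_sw => u1 u2; apply: eq_sw => x1 x2; rewrite scalerAl.
Qed.

(** With S the antipode and legs numbered, S(xy) = S(x1 y1) target(x2 y2) = S(x1 y1) x2 target(y2)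
    S(x3) = S(x1 y1) x2 y2 S(y3) S(x3) = source(x1 y1) S(y2) S(x2) = S(y1) source(x1) y2 S(y3) S(x2)
    = S(y1) source(x1) target(y2) S(x2). By [base_comm] the two middle factors swap, and S(y1)
    target(y2) and source(x1) S(x2) collapse to S(y) and S(x). *)
Lemma antipodeM x y : antipode (x * y) = antipode y * antipode x.
Proof.
have tl := lin_target; have sl := lin_source.
rewrite -[LHS]antipode_target sw_mul; last by lin.
transitivity (\S_(x1, z | x) \S_(a, b | z) \S_(y1, y2 | y)
    antipode (x1 * y1) * (a * target y2 * antipode b)).
  apply: eq_sw => x1 z; rewrite sw_exchange; apply: eq_sw => y1 y2.
  by rewrite -target_mul mulr_swr.
rewrite -(sw_coassoc (f := fun x1 a b => \S_(y1, y2 | y)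
    antipode (x1 * y1) * (a * target y2 * antipode b))); last by lin.
(* Both sides are now sums over the same coproduct of [x], and are compared for fixed legs z and
   b. *)
rewrite -[antipode x in RHS]source_antipode mulr_swr; apply: eq_sw => z b.
transitivity (\S_(w, d | y) source (z * w) * (antipode d * antipode b)).
  transitivity (\S_(x1, a | z) \S_(w, d | y) \S_(y1, c | w)
      antipode (x1 * y1) * (a * c) * (antipode d * antipode b)).
    apply: eq_sw => x1 a.
    rewrite (sw_coassoc (f := fun y1 c d =>
      antipode (x1 * y1) * (a * c) * (antipode d * antipode b))); last by lin.
    apply: eq_sw => y1 y2; rewrite -mul_antipode mulr_swr mulr_swl mulr_swr.
    by apply: eq_sw => c d; rewrite !mulrA.
  rewrite sw_exchange; apply: eq_sw => w d.
  rewrite -antipode_mul sw_mul; last by lin.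
  rewrite mulr_swl; apply: eq_sw => x1 a.
  by rewrite mulr_swl.
transitivity (\S_(p, v | y) \S_(q, d | v)
    antipode p * source z * (q * antipode d) * antipode b).
  rewrite -(sw_coassoc (f := fun p q d =>
    antipode p * source z * (q * antipode d) * antipode b)); last by lin.
  apply: eq_sw => w d; rewrite -mul_source mulr_swl.
  by apply: eq_sw => p q; rewrite !mulrA.
rewrite -[antipode y in RHS]antipode_target mulr_swl; apply: eq_sw => p v.
rewrite -mulr_swl -mulr_swr mul_antipode -[antipode p * _ * _]mulrA.
by rewrite /target /source -base_comm ?mulrA //; lin.
Qed.

End SweedlerRules.

(** * The inverse of the antipode *)

Section AntipodeStar.
Variables (C : numClosedFieldType) (A : weakHopfCStarType C).
Implicit Types (x y z : A).

Local Notation "'\S_' ( a , b | x ) E" := (sw (fun a b => E) x)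
  (at level 41, a name, b name, E at level 41).

(** For the coopposite coproduct, [cosource] is the target map and [cotarget] the source map; the
    names follow the base in which the values lie. *)
Definition cotarget x : A := left_base (fun a => counit (x * a)).
Definition cosource x : A := right_base (fun a => counit (a * x)).

(* The inverse of the antipode. *)
Definition coantipode x : A := star (antipode (star x)).

Lemma lin_coantipode : lin coantipode.
Proof. exact: lin_star_star (lin_antipode (@lin_id _ _)). Qed.

Lemma star_source x : star (source (star x)) = cosource x.
Proof.
rewrite /source /right_base -[X in star (sw _ X)]star1 sw_star; last by lin.
rewrite star_sw; apply: eq_sw => a b.
by rewrite starZ -starM counit_star conjCK starK.
Qed.

Lemma star_target x : star (target (star x)) = cotarget x.
Proof.
rewrite /target /left_base -[X in star (sw _ X)]star1 sw_star; last by lin.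
rewrite star_sw; apply: eq_sw => a b.
by rewrite starZ -starM counit_star conjCK starK.
Qed.

(** An antipode law for the coopposite coproduct: the star of [antipode_mul] at [star x]. *)
Lemma mul_coantipode x : \S_(a, b | x) b * coantipode a = cosource x.
Proof.
rewrite -star_source -antipode_mul sw_star; last by lin.
by rewrite star_sw; apply: eq_sw => a b; rewrite starM starK.
Qed.

Lemma coantipode_mul x : \S_(a, b | x) coantipode b * a = cotarget x.
Proof.
rewrite -star_target -mul_antipode sw_star; last by lin.
by rewrite star_sw; apply: eq_sw => a b; rewrite starM starK.
Qed.

Lemma coantipode_cosource x :
  \S_(y, c | x) coantipode c * cosource y = coantipode x.
Proof.
have sl := @lin_source _ A.
rewrite [RHS]/coantipode -source_antipode sw_star; last by lin.
by rewrite star_sw; apply: eq_sw => y c; rewrite starM star_source.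
Qed.

Lemma target1 : target (1 : A) = 1.
Proof.
rewrite -[RHS]counit_l; apply: eq_sw => a b; by rewrite mulr1.
Qed.

Lemma source1 : source (1 : A) = 1.
Proof.
rewrite -[RHS]counit_r; apply: eq_sw => a b; by rewrite mul1r.
Qed.

(** For r in the right base, target(r) = 1_(1) S(r 1_(2)) by [sw_mul_right_base], and this is
    target(1) S(r) = S(r) by antimultiplicativity. *)
Lemma antipode_right_base (g : A -> C^o) :
  lin g -> antipode (right_base g) = target (right_base g).
Proof.
move=> gl; rewrite -mul_antipode -[X in sw _ X]mulr1.
rewrite (sw_mul_right_base (f := fun a b => a * antipode b)) //; last by lin.
transitivity (target 1 * antipode (right_base g)); first by rewrite target1 mul1r.
rewrite -mul_antipode mulr_swl; apply: eq_sw => a b.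
by rewrite antipodeM mulrA.
Qed.

Lemma antipode_left_base (g : A -> C^o) :
  lin g -> antipode (left_base g) = source (left_base g).
Proof.
move=> gl; rewrite -antipode_mul -[X in sw _ X]mul1r.
rewrite (sw_mul_left_base (f := fun a b => antipode a * b)) //; last by lin.
transitivity (antipode (left_base g) * source 1); first by rewrite source1 mulr1.
rewrite -antipode_mul mulr_swr; apply: eq_sw => a b.
by rewrite antipodeM mulrA.
Qed.

Lemma antipode_cosource x : antipode (cosource x) = target x.
Proof.
rewrite antipode_right_base; last by lin.
rewrite /target /left_base; apply: eq_sw => u1 u2; congr (_ *: _).
rewrite -[in RHS](mulr1 u1) counit_weakM.
have el : lin ((fun z => counit (u1 * z)) : A -> C^o) by lin.
rewrite (lin_of_sw _ _ el); apply: eq_sw => v1 v2.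
by rewrite (linZ _ _ el) mulrC.
Qed.

Lemma antipode_cotarget x : antipode (cotarget x) = source x.
Proof.
rewrite antipode_left_base; last by lin.
rewrite /source /right_base; apply: eq_sw => u1 u2; congr (_ *: _).
rewrite -[in RHS](mulr1 x) counit_weakM.
have el : lin ((fun z => counit (z * u2)) : A -> C^o) by lin.
rewrite (lin_of_sw _ _ el); apply: eq_sw => v1 v2.
by rewrite (linZ _ _ el).
Qed.

(* [F := antipode \o coantipode] satisfies [F * S = target] and [S * F = source]
   for the convolution product, as the identity does, so that
   [F = F * S * F = F * S * id = id * S * id = id]. *)
Lemma antipode_coantipode x : antipode (coantipode x) = x.
Proof.
have tl := lin_coantipode; have sl := @lin_source _ A.
pose F y := antipode (coantipode y).
have Fl : lin F by rewrite /F; lin.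
have FS y : \S_(a, b | y) F a * antipode b = target y.
  rewrite -antipode_cosource -mul_coantipode.
  rewrite (lin_of_sw _ _ (lin_antipode (@lin_id _ _))).
  by apply: eq_sw => a b; rewrite antipodeM.
have SF y : \S_(a, b | y) antipode a * F b = source y.
  rewrite -antipode_cotarget -coantipode_mul.
  rewrite (lin_of_sw _ _ (lin_antipode (@lin_id _ _))).
  by apply: eq_sw => a b; rewrite antipodeM.
transitivity (\S_(y, c | x) target y * F c).
  rewrite -[in LHS]coantipode_cosource (lin_of_sw _ _ (lin_antipode (@lin_id _ _))).
  by apply: eq_sw => y c; rewrite antipodeM antipode_cosource.
have E (G : A -> A) : lin G -> \S_(y, c | x) target y * G c
    = \S_(a, y | x) F a * \S_(b, c | y) antipode b * G c.
  move=> Gl.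
  transitivity (\S_(y, c | x) \S_(a, b | y) F a * (antipode b * G c)).
    apply: eq_sw => y c; rewrite -FS mulr_swl.
    by apply: eq_sw => a b; rewrite mulrA.
  rewrite (sw_coassoc (f := fun a b c => F a * (antipode b * G c))); last by lin.
  by apply: eq_sw => a y; rewrite mulr_swr.
rewrite -[RHS]target_mul_id E // (E id) //; apply: eq_sw => a y.
by rewrite SF -antipode_mul.
Qed.

(** The star carries [antipode_coantipode] at [star x] to the opposite composite at x. *)
Lemma coantipode_antipode x : coantipode (antipode x) = x.
Proof.
rewrite -[in RHS](starK x) -[star x]antipode_coantipode.
by rewrite /coantipode starK -/(coantipode (antipode x)).
Qed.

Lemma starlK : involutive (@starl C A).
Proof. exact: coantipode_antipode. Qed.

(** Expanding x target(y) by the counit gives counit(x_(1) target(y)) x_(2), and [counit_mulC] turns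
    target(y) into y there. *)
Lemma mul_target x y : \S_(a, b | x) counit (a * y) *: b = x * target y.
Proof.
have cl : lin ((fun a => counit (a * y)) : A -> C^o) by lin.
rewrite -[RHS](sw_counitl (f := id)) //.
rewrite (sw_mul_left_base (f := fun a b => counit a *: b)) //; last by lin.
apply: eq_sw => a b; congr (_ *: _).
rewrite -[a in LHS]mulr1 counit_mulC.
have el : lin ((fun z => counit (a * z)) : A -> C^o) by lin.
rewrite (lin_of_sw _ _ el); apply: eq_sw => v1 v2.
by rewrite (linZ _ _ el) mulrC.
Qed.

End AntipodeStar.

(** * Slicing by elements of [A] *)

Section Slices.
Variables (C : numClosedFieldType) (A : weakHopfCStarType C).
Implicit Types (V : lmodType C) (a b : A) (psi : dual A).

(** The map [slice] for an arbitrary left factor, so that it also applies to the outer leg of an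
    iterated tensor product. *)
Definition vslice V a (t : tens V (dual A)) : V :=
  tlift (fun v psi => pairing psi a *: v) t.

Lemma lin_pairingl a : lin ((fun psi => pairing psi a) : dual A -> C^o).
Proof. by move=> k s t; rewrite pairingD pairingZ. Qed.

Lemma lin_pairingr psi : lin (pairing psi : A -> C^o).
Proof. exact: pairing_linear. Qed.

Lemma slice_bilin V a : bilin (fun (v : V) psi => pairing psi a *: v).
Proof.
split=> [psi|v]; first exact: (lin_scaler _ (@lin_id _ _)).
exact: (lin_scalel _ (lin_pairingl a)).
Qed.

Lemma lin_vslice V a : lin (@vslice V a).
Proof. exact: (tlift_linear (slice_bilin V a)). Qed.

Lemma lin_vslicel V (t : tens V (dual A)) : lin (fun a => vslice a t).
Proof. by apply: lin_tliftl => v psi; apply: lin_scalel; apply: lin_pairingr. Qed.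

Lemma vslice_pure V a (v : V) psi : vslice a (v ⊗ psi) = pairing psi a *: v.
Proof. exact: (tlift_pure _ _ (slice_bilin V a)). Qed.

Lemma lin_tcoord (W : vectType C) (i : 'I_(\dim {:W})) :
  lin (tcoord i : W -> C^o).
Proof. by move=> k u v; rewrite /tcoord linearP. Qed.

Definition dbase (j : 'I_(\dim {:A})) : dual A := dual_of (tcoord j).

Lemma pairing_dbase j a : pairing (dbase j) a = tcoord j a.
Proof. by rewrite dual_ofE //; apply: lin_tcoord. Qed.

(** The inverse of slicing, written with a basis of [A] and its dual basis. *)
Definition unslice V (f : A -> V) : tens V (dual A) :=
  \sum_j f (tbase j) ⊗ dbase j.

Lemma dual_sum psi : psi = \sum_j pairing psi (tbase j) *: dbase j.
Proof.
apply/dualP => a; rewrite [a in LHS]tbase_sum (lin_sum _ (lin_pairingr psi)).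
rewrite (lin_sum (f := (fun phi => pairing phi a) : dual A -> C^o)
  _ (lin_pairingl a)).
apply: eq_bigr => j _.
by rewrite (linZ _ _ (lin_pairingr psi)) pairingZ pairing_dbase mulrC.
Qed.

Lemma unslice_vslice V (t : tens V (dual A)) : unslice (fun a => vslice a t) = t.
Proof.
rewrite [RHS]tens_sum /unslice.
have [pl pr] := pure_bilin V (dual A).
under eq_bigr => j _.
  rewrite [X in X ⊗ _](_ : _ = \sum_i pairing (tbase i) (tbase j) *: t i) //.
  rewrite (lin_sum (f := fun v => v ⊗ dbase j) _ (pl _)); over.
rewrite exchange_big; apply: eq_bigr => i _.
rewrite [X in _ = _ ⊗ X]dual_sum (lin_sum _ (pr _)).
apply: eq_bigr => j _.
by rewrite (linZ _ _ (pr _)) (linZ (f := fun v => v ⊗ _) _ _ (pl _)).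
Qed.

Lemma vslice_inj V (s t : tens V (dual A)) :
  (forall a, vslice a s = vslice a t) -> s = t.
Proof.
move=> e; rewrite -[s]unslice_vslice -[t]unslice_vslice.
by apply: eq_bigr => j _; rewrite e.
Qed.

Lemma vslice_unslice V (f : A -> V) a : lin f -> vslice a (unslice f) = f a.
Proof.
move=> fl; rewrite (lin_sum _ (@lin_vslice V a)) [a in RHS]tbase_sum (lin_sum _ fl).
by apply: eq_bigr => j _; rewrite vslice_pure pairing_dbase (linZ _ _ fl).
Qed.

(** The product of the dual is the transpose of [Delta]; this matches multiplicativity of a coaction
    with [act_mulr]. *)
Lemma vslice_mul (B : algType C) a (s t : tens B (dual A)) :
  vslice a (s * t) = sw (fun a1 a2 => vslice a1 s * vslice a2 t) a.
Proof.
rewrite /vslice tlift_tens_mul; last exact: slice_bilin.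
transitivity (sw (fun a1 a2 => tlift (fun v psi => tlift (fun w phi =>
    (pairing psi a1 *: v) * (pairing phi a2 *: w)) t) s) a).
  rewrite /sw [RHS]tlift_exchange; apply: eq_tlift => v psi.
  rewrite [RHS]tlift_exchange; apply: eq_tlift => w phi.
  rewrite [pairing _ _]dmulE scaler_suml; apply: eq_bigr => i _.
  by rewrite -scalerAl -scalerAr scalerA.
by apply: eq_sw => a1 a2; rewrite /tlift big_distrlr.
Qed.

Lemma vslice_tmap V V' (f : V -> V') a (t : tens V (dual A)) :
  lin f -> vslice a (tmap f id t) = f (vslice a t).
Proof.
move=> fl; rewrite /vslice tlift_tmap; last exact: slice_bilin.
by rewrite (lin_tlift _ _ fl); apply: eq_tlift => v psi; rewrite (linZ _ _ fl).
Qed.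

Lemma lin_pairing2 a b :
  lin ((fun d => pairing2 d a b) : tens (dual A) (dual A) -> C^o).
Proof. exact: tlift_linear (prod_bilin (lin_pairingl a) (lin_pairingl b)). Qed.

Lemma vslice2_tassoc V a b (t : tens V (tens (dual A) (dual A))) :
  vslice a (vslice b (tassoc t)) = tlift (fun v d => pairing2 d a b *: v) t.
Proof.
rewrite {2}/vslice tlift_tassoc; last exact: slice_bilin.
rewrite (lin_tlift _ _ (@lin_vslice V a)); apply: eq_tlift => v d.
rewrite (lin_tlift _ _ (@lin_vslice V a)) /pairing2 scaler_suml.
apply: eq_bigr => i _.
by rewrite (linZ _ _ (@lin_vslice V a)) vslice_pure scalerA mulrC.
Qed.

Lemma pairing2_bilin V a b :
  bilin (fun (v : V) (d : tens (dual A) (dual A)) => pairing2 d a b *: v).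
Proof.
split=> [d|v]; first exact: (lin_scaler _ (@lin_id _ _)).
exact: (lin_scalel _ (lin_pairing2 a b)).
Qed.

(** The coproduct of the dual is the transpose of the product of [A]; this matches coassociativity
    with [act_mul]. *)
Lemma vslice2_dcomul V a b (t : tens V (dual A)) :
  vslice a (vslice b (tassoc (tmap id dcomul t))) = vslice (a * b) t.
Proof.
rewrite vslice2_tassoc tlift_tmap; last exact: pairing2_bilin.
by apply: eq_tlift => v psi; rewrite dcomulE.
Qed.

Lemma pairing1 a : pairing (1 : dual A) a = counit a.
Proof. exact: dunitE. Qed.

End Slices.

(** * Coaction axioms against action axioms *)

Section Correspondence.
Variables (C : numClosedFieldType) (A : weakHopfCStarType C).
Variable M : starAlgType C.
Implicit Types (a b : A) (m n : M) (rho : M -> tens M (dual A)).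

Lemma vslice_star a (t : tens M (dual A)) :
  vslice a (tmap star dstar t) = star (vslice (starl a) t).
Proof.
rewrite /vslice tlift_tmap; last exact: slice_bilin.
rewrite star_tlift; apply: eq_tlift => m psi; by rewrite dstarE starZ.
Qed.

(** The unit of the dual is [counit], so its coproduct pairs with a_(1) and b to counit(a_(1) b),
    while [rho 1] takes the other leg of a. *)
Lemma vslice2_unit rho a b :
  vslice a (vslice b (tassoc ((1 : M) ⊗ dcomul (1 : dual A)) * (rho 1 ⊗ (1 : dual A))))
  = sw (fun a1 a2 => counit (a1 * b) *: vslice a2 (rho 1)) a.
Proof.
rewrite vslice_mul.
transitivity (vslice a (vslice b (tassoc ((1 : M) ⊗ dcomul (1 : dual A))) * rho 1)).
  (* The last leg of [rho 1 ⊗ 1] is [counit], which absorbs b_(2); so b slices the left factor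
     only. *)
  congr vslice; rewrite -[b in RHS]counit_r.
  rewrite (lin_tlift _ _ (@lin_vslicel _ _ _ _)) mulr_suml.
  apply: eq_bigr => i _; rewrite vslice_pure pairing1 (linZ _ _ (lin_vslicel _)).
  by rewrite -scalerAl -scalerAr.
rewrite vslice_mul; apply: eq_sw => a1 a2.
rewrite vslice2_tassoc tlift_pure; last exact: pairing2_bilin.
by rewrite dcomulE pairing1 -scalerAl mul1r.
Qed.

Lemma coaction_actionP rho : linear rho ->
  comodule_algebra_coaction rho
  <-> module_algebra_action (fun a m => slice a (rho m)).
Proof.
move=> rl; change (@slice C A M) with (@vslice C A M).
have coassocP : (forall m, tmap rho id (rho m) = tassoc (tmap id dcomul (rho m)))
    <-> forall a b m, vslice (a * b) (rho m) = vslice a (rho (vslice b (rho m))).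
  split=> [e a b m|e m]; first by rewrite -vslice2_dcomul -e vslice_tmap.
  by apply: vslice_inj => b; apply: vslice_inj => a; rewrite vslice2_dcomul vslice_tmap.
split=> [[_ rM rS rA r1 rU]|[_ aA a1 aM aS aU]].
  (* Since [dcounit] is evaluation at 1, the counit axiom is [act_one] by conversion. *)
  move/coassocP in rA; split=> //.
  - split=> [m|a]; first exact: lin_vslicel.
    exact: (lin_comp (@lin_vslice _ _ _ _)).
  - by move=> a m n; rewrite rM vslice_mul.
  - by move=> a m; rewrite rS vslice_star starlK.
  (* The unit axiom is sliced at 1 and a only: its left side becomes the action of target(a) on
     1. *)
  move=> a; rewrite -[X in _ = vslice X _]/(sw _ _) mul_antipode.
  have := vslice2_unit rho 1 a; rewrite rU vslice2_dcomul mul1r => ->.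
  rewrite (lin_of_sw _ _ (lin_vslicel _)); apply: eq_sw => u1 u2.
  by rewrite (linZ _ _ (lin_vslicel _)).
split=> //; last 1 first.
- apply: vslice_inj => b; apply: vslice_inj => a.
  (* Conversely, [aU] replaces b by target(b) in the action of ab on 1, and [mul_target] expands a
     target(b); this gives the slices at all a and b. *)
  rewrite vslice2_unit vslice2_dcomul aA (aU b) -[tlift _ _ in RHS]/(sw _ _).
  rewrite mul_antipode -aA -mul_target (lin_of_sw _ _ (lin_vslicel _)).
  apply: eq_sw => u1 u2.
  by rewrite (linZ _ _ (lin_vslicel _)).
- by move=> m n; apply: vslice_inj => a; rewrite vslice_mul aM.
- by move=> m; apply: vslice_inj => a; rewrite vslice_star aS starlK.
exact/coassocP.
Qed.

Lemma linear_unslice (act : A -> M -> M) :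
  (forall a, lin (act a)) -> linear (fun m => unslice (act^~ m)).
Proof.
move=> al k m n; rewrite /unslice scaler_sumr -big_split; apply: eq_bigr => j _ /=.
by rewrite al (pure_bilin _ _).1.
Qed.

Lemma action_unslice (act : A -> M -> M) : bilin act ->
  (fun a m => slice a (unslice (act^~ m))) = act.
Proof.
move=> [al _]; apply/funext => a; apply/funext => m.
exact: (vslice_unslice _ (al m)).
Qed.

(** The functionals tested by [tens_weak_cvg] on the dual are exactly the evaluations at elements of
    [A]. *)
Lemma weakly_continuous_slice (H : completeNormedModType C)
    (dot : {dot H for (@Num.conj C)}) (pi : M -> H -> H) rho :
  tens_weakly_continuous dot pi rho <->
  forall a, weakly_continuous dot pi (fun m => slice a (rho m)).
Proof.
split=> [rc a F m PF Fm|ac F m PF Fm phi].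
  have pl := lin_pairingl a.
  pose p : {scalar dual A} := HB.pack ((fun psi => pairing psi a) : dual A -> C)
    (GRing.isLinear.Build C (dual A) C _ ((fun psi => pairing psi a)) pl).
  exact: (rc F m PF Fm p).
(* Reflexivity in finite dimension: [phi] is evaluation at this element. *)
pose a := \sum_j phi (dbase j) *: tbase j.
have phiE psi : phi psi = pairing psi a.
  rewrite [psi in LHS]dual_sum linear_sum (lin_sum _ (lin_pairingr psi)).
  apply: eq_bigr => j _; rewrite linearZ (linZ _ _ (lin_pairingr psi)).
  exact: mulrC.
have sliceE t : tlift (fun n psi => phi psi *: n) t = slice a t.
  by apply: eq_tlift => n psi; rewrite phiE.
have := ac a F m PF Fm; rewrite -sliceE.
by under eq_fun do rewrite -sliceE.
Qed.

End Correspondence.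

(** * The bijection and its restriction to weakly continuous maps *)

Theorem proposition2p1p2 (R : realType)
    (A : weakHopfCStarType R[i]) (M : starAlgType R[i]) :
  set_bij [set rho : M -> tens M (dual A) | comodule_algebra_coaction rho]
          [set act : A -> M -> M | module_algebra_action act]
          (fun rho a m => slice a (rho m))
  /\
  (forall (H : completeNormedModType R[i]) (dot : {dot H for Num.conj})
      (pi : M -> H -> H), von_neumann_algebra dot pi ->
    set_bij [set rho : M -> tens M (dual A) |
               comodule_algebra_coaction rho /\
               tens_weakly_continuous dot pi rho]
            [set act : A -> M -> M |
               module_algebra_action act /\
               forall a, weakly_continuous dot pi (act a)]
            (fun rho a m => slice a (rho m))).
Proof.
have sliceI (rho rho' : M -> tens M (dual A)) :
    (fun a m => slice a (rho m)) = (fun a m => slice a (rho' m)) -> rho = rho'.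
  move=> e; apply/funext => m; apply: vslice_inj => a.
  exact: (congr1 (fun act => act a m) e).
have surj (act : A -> M -> M) : module_algebra_action act ->
    exists2 rho, comodule_algebra_coaction rho & (fun a m => slice a (rho m)) = act.
  move=> actP; have ab := act_bilin actP; have e := action_unslice ab.
  (* The coaction is rebuilt from the maps a |-> act a m. *)
  exists (fun m => unslice (act^~ m)) => //; apply/coaction_actionP.
    exact: linear_unslice ab.2.
  by rewrite e.
split=> [|H dot pi _]; split.
- by move=> rho rhoP /=; apply/coaction_actionP => //; apply: coact_linear rhoP.
- by move=> rho rho' _ _; apply: sliceI.
- by move=> act /surj [rho rhoP e]; exists rho.
- move=> rho [rhoP rc]; split; last exact/weakly_continuous_slice.
  by apply/coaction_actionP => //; apply: coact_linear rhoP.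
- by move=> rho rho' _ _; apply: sliceI.
move=> act [/surj [rho rhoP <-] ac]; exists rho => //; split => //.
exact/weakly_continuous_slice.
Qed.
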